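(* For a connected Lie group $G$, $TC(G)=TC^M(G)=\mathrm{cat}(G)$.
   Context: For a space $X$, $PX=X^{[0,1]}$ is the space of all paths in $X$ and $\pi:PX\to X\times X$ is the fibration $\pi(f)=(f(0),f(1))$. $TC(X)$ is the minimal number $k$ such that $X\times X$ admits an open cover $U_1,\dots,U_k$ such that over each $U_i$ there is a continuous section $s_i:U_i\to PX$ of $\pi$. A section $s$ of $\pi$ over $U\subset X\times X$ is called reserved if $s(x,x)$ is the constant path at $x$ for every $(x,x)\in U$. $TC^M(X)$ (monoidal topological complexity) is the minimal $k$ such that $X\times X$ admits an open cover $U_1,\dots,U_k$ with continuous reserved sections $s_i:U_i\to PX$ of $\pi$. $\mathrm{cat}(X)$ is the (non-reduced) Lusternik-Schnirelmann category: the minimal number $k$ such that $X$ can be covered by $k$ open sets $U_1,\dots,U_k$ each contractible to a point in $X$ (so $\mathrm{cat}$ of a point is $1$). *)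

(* Defs.v *)
From HB Require Import structures.
From mathcomp Require Import all_boot all_order all_algebra.
From mathcomp Require Import all_classical all_reals all_analysis.

Set Implicit Arguments.
Unset Strict Implicit.
Unset Printing Implicit Defensive.

Import Order.TTheory GRing.Theory Num.Theory numFieldNormedType.Exports.

Local Open Scope classical_set_scope.
Local Open Scope ring_scope.

(* [Ck_on k U f]: on the open set [U], all iterated partial derivatives of [f]
   of order at most [k] exist and are continuous. *)
Fixpoint Ck_on (R : realType) (n m : nat) (k : nat)
    (U : set 'rV[R]_n) (f : 'rV[R]_n -> 'rV[R]_m) : Prop :=
  (forall x, U x -> {for x, continuous f}) /\
  match k with
  | 0 => True
  | k'.+1 => forall i : 'I_n,
      (forall x, U x -> derivable f x (delta_mx 0 i)) /\
      Ck_on k' U (fun x => 'D_(delta_mx 0 i) f x)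
  end.

Definition smooth_on (R : realType) (n m : nat)
    (U : set 'rV[R]_n) (f : 'rV[R]_n -> 'rV[R]_m) : Prop :=
  forall k, Ck_on k U f.

(* [chart_fun] only matters on [chart_dom], and [chart_inv] only on the image
   of [chart_dom]; the conditions making this a chart are in [is_chart]. *)
Record chart (R : realType) (n : nat) (M : Type) := Chart {
  chart_dom : set M;
  chart_fun : M -> 'rV[R]_n;
  chart_inv : 'rV[R]_n -> M
}.

Definition is_chart (R : realType) (n : nat) (M : topologicalType)
    (phi : chart R n M) : Prop :=
  [/\ open (chart_dom phi),
      open (chart_fun phi @` chart_dom phi),
      forall x, chart_dom phi x -> chart_inv phi (chart_fun phi x) = x,
      {within chart_dom phi, continuous (chart_fun phi)} &
      {within chart_fun phi @` chart_dom phi, continuous (chart_inv phi)}].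

(* The atlas of a manifold need not be maximal. *)
Definition smooth_atlas (R : realType) (n : nat) (M : topologicalType)
    (A : set (chart R n M)) : Prop :=
  [/\ forall phi, A phi -> is_chart phi,
      forall x, exists2 phi, A phi & chart_dom phi x &
      forall phi psi, A phi -> A psi ->
        smooth_on (chart_fun phi @` (chart_dom phi `&` chart_dom psi))
                  (chart_fun psi \o chart_inv phi)].

Definition smooth_map (R : realType) (n m : nat) (M N : topologicalType)
    (A : set (chart R n M)) (B : set (chart R m N)) (f : M -> N) : Prop :=
  continuous f /\
  forall phi psi, A phi -> B psi ->
    smooth_on (chart_fun phi @` (chart_dom phi `&` f @^-1` chart_dom psi))
              (chart_fun psi \o f \o chart_inv phi).

(* The product manifold, with R^n x R^m identified with R^(n + m). *)
Definition prod_chart (R : realType) (n m : nat) (M N : Type)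
    (phi : chart R n M) (psi : chart R m N) : chart R (n + m) (M * N) :=
  {| chart_dom := chart_dom phi `*` chart_dom psi;
     chart_fun := fun p => row_mx (chart_fun phi p.1) (chart_fun psi p.2);
     chart_inv := fun z => (chart_inv phi (lsubmx z), chart_inv psi (rsubmx z))
  |}.

Definition prod_atlas (R : realType) (n m : nat) (M N : Type)
    (A : set (chart R n M)) (B : set (chart R m N)) :
    set (chart R (n + m) (M * N)) :=
  [set prod_chart phi psi | phi in A & psi in B].

HB.mixin Record isLieGroup (R : realType) (n : nat) (G : Type)
    of Group G & Topological G := {
  lie_hausdorff : hausdorff_space G;
  lie_second_countable : @second_countable G;
  lie_atlas : set (chart R n G);
  lie_atlas_smooth : smooth_atlas lie_atlas;
  lie_mul_smooth : smooth_map (prod_atlas lie_atlas lie_atlas) lie_atlas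
                     (fun p : G * G => (p.1 * p.2)%g);
  lie_inv_smooth : smooth_map lie_atlas lie_atlas (fun x : G => (x^-1)%g)
}.

#[short(type="lieGroupType")]
HB.structure Definition LieGroup (R : realType) (n : nat) :=
  {G of isLieGroup R n G & Group G & Topological G}.

Definition unit_interval (R : realType) : topologicalType :=
  set_type (`[0, 1]%classic : set R).

Lemma mem_unit_interval0 (R : realType) : (0 : R) \in (`[0, 1]%classic : set R).
Proof. by rewrite inE /= in_itv /= lexx ler01. Qed.

Lemma mem_unit_interval1 (R : realType) : (1 : R) \in (`[0, 1]%classic : set R).
Proof. by rewrite inE /= in_itv /= lexx ler01. Qed.

Definition I0 (R : realType) : unit_interval R :=
  exist _ 0 (mem_unit_interval0 R).
Definition I1 (R : realType) : unit_interval R :=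
  exist _ 1 (mem_unit_interval1 R).

Definition path_space (R : realType) (X : topologicalType) : Type :=
  continuousType (unit_interval R) X.

HB.instance Definition _ (R : realType) (X : topologicalType) :=
  Topological.copy (path_space R X)
    (initial_topology
       (id : path_space R X -> {compact-open, unit_interval R -> X})).

Definition endpoints (R : realType) (X : topologicalType)
    (f : path_space R X) : X * X :=
  ((f : continuousType _ _) (I0 R), (f : continuousType _ _) (I1 R)).

(* The values of [s] outside [U] are irrelevant. *)
Definition is_section (R : realType) (X : topologicalType)
    (U : set (X * X)) (s : X * X -> path_space R X) : Prop :=
  {within U, continuous s} /\ forall p, U p -> endpoints (s p) = p.

Definition reserved_on (R : realType) (X : topologicalType)
    (U : set (X * X)) (s : X * X -> path_space R X) : Prop :=
  forall x, U (x, x) -> s (x, x) = (cst x : continuousType (unit_interval R) X).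

Definition contractible_in (R : realType) (X : topologicalType)
    (U : set X) : Prop :=
  exists (x0 : X) (H : X * unit_interval R -> X),
    {within U `*` setT, continuous H} /\
    forall x, U x -> H (x, I0 R) = x /\ H (x, I1 R) = x0.

Definition open_cover_by (X : topologicalType) (P : set X -> Prop) (k : nat) :
    Prop :=
  exists U : 'I_k -> set X,
    [/\ forall i, open (U i), \bigcup_i U i = setT & forall i, P (U i)].

(* The least natural number satisfying [P], or [None] (standing for infinity)
   if there is none. *)
Definition least (P : nat -> Prop) : option nat :=
  match pselect (exists k, `[< P k >]) with
  | left exP => Some (ex_minn exP)
  | right _ => None
  end.

Definition TC (R : realType) (X : topologicalType) : option nat :=
  least (open_cover_by (fun U : set (X * X) =>
    exists s : X * X -> path_space R X, is_section U s)).

Definition TCM (R : realType) (X : topologicalType) : option nat :=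
  least (open_cover_by (fun U : set (X * X) =>
    exists s : X * X -> path_space R X, is_section U s /\ reserved_on U s)).

Definition LScat (R : realType) (X : topologicalType) : option nat :=
  least (open_cover_by (@contractible_in R X)).

(* Main.v *)
Require Import Defs.
From mathcomp Require Import all_boot all_order all_algebra.
From mathcomp Require Import all_classical all_reals all_analysis.

(** Everything reduces to two ways of pulling back open covers, each of which
    preserves the number of members; since TC <= TCM is immediate, they close a
    cycle of inequalities cat <= TC <= TCM <= cat.

    - Along x |-> (x, 1) : G -> G * G.  A section of the endpoint fibration over
      an open set U assigns to (x, 1) a path from x to 1; following these paths
      contracts [set x | U (x, 1)] to 1 ([section_contractible]).
    - Along (a, b) |-> b^-1 * a : G * G -> G.  If H contracts U to 1, then
      t |-> b * H (b^-1 * a, t) is a path from a to b, defined whenever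
      b^-1 * a lies in U.  It is constant for a = b as soon as H keeps 1 fixed
      ([contractible_reserved_section]).

    What makes the second step work is that any contraction H of U can be
    corrected to one that ends at 1 and keeps 1 fixed if 1 is in U, by multiplying
    it on the right by a suitable path g in G ([contractible_in_pointed]).  If 1
    is in U, the inverse of the track t |-> H (1, t) serves as g.  Otherwise H
    only has to be moved from its final point x0 to 1, and g is a path from 1 to
    x0^-1; it exists because the points joined to 1 form a subgroup, which is a
    neighbourhood of 1 by the charts and hence all of the connected group G
    ([connected_joined1]).  Multiplying paths pointwise takes the place of
    concatenating them throughout.

    Sections take values in a path space with the compact-open topology, so the
    translation between sections and homotopies is the exponential law, which
    holds because the unit interval is compact
    ([uncurry_path_within], [curry_path_within]). *)

Set Implicit Arguments.
Unset Strict Implicit.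
Unset Printing Implicit Defensive.

Import Order.TTheory GRing.Theory Num.Theory numFieldNormedType.Exports.

Local Open Scope classical_set_scope.
Local Open Scope ring_scope.

(** * The exponential law for path spaces *)

Lemma compact_set_type (X : topologicalType) (A : set X) :
  compact A -> compact [set: set_type A].
Proof.
move=> cA F FF _.
have [|p [Ap clp]] := cA (fmap set_val F) _.
  by apply: (@filterS _ F _ setT) (filterT) => x _ /=; exact: set_valP.
exists (exist _ p (mem_set Ap)); split=> // B C FB [_ [[V oV <-] /= Vp VC]].
have [||q [[y By <-] Vy]] := clp (set_val @` B) V.
- by apply: (@filterS _ F _ B) FB => y By; exists y.
- exact: open_nbhs_nbhs.
by exists y; split=> //; exact: VC.
Qed.

Lemma unit_interval_locally_compact (R : realType) :
  locally_compact [set: unit_interval R].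
Proof.
move=> x _; rewrite withinET; exists setT; first exact: filterT.
by split=> //; exact: compact_set_type (@segment_compact R 0 1).
Qed.

(** Evaluation is jointly continuous for the compact-open topology because the
    unit interval is locally compact and regular. *)
Lemma eval_path_continuous (R : realType) (X : topologicalType) :
  continuous (fun q : path_space R X * unit_interval R =>
                (q.1 : continuousType _ _) q.2).
Proof.
rewrite (_ : (fun q => _) = @eval (unit_interval R) X); last first.
  by apply/funext => -[].
apply: (eval_continuous (@unit_interval_locally_compact R)).
exact: uniform_regular.
Qed.

Lemma continuous_pair (T X Y : topologicalType) (f : T -> X) (g : T -> Y)
    (x : T) :
  {for x, continuous f} -> {for x, continuous g} ->
  {for x, continuous (fun y => (f y, g y))}.
Proof. exact: cvg_pair. Qed.

Lemma openX_setT (X Y : topologicalType) (U : set X) :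
  open U -> open (U `*` [set: Y]).
Proof.
by move=> oU; rewrite setXT; apply: open_comp => // q _; exact: cvg_fst.
Qed.

Lemma uncurry_path_within (R : realType) (T X : topologicalType) (U : set T)
    (h : T -> path_space R X) :
  open U -> {within U, continuous h} ->
  {within U `*` setT,
     continuous (fun q => (h q.1 : continuousType _ _) q.2)}.
Proof.
move=> oU; rewrite !continuous_open_subspace //; last exact: openX_setT.
move=> ch [x t]; rewrite inE /= => -[Ux _].
apply: (@continuous_comp (T * unit_interval R)%type
  (path_space R X * unit_interval R)%type X (fun q => (h q.1, q.2))
  (fun q => (q.1 : continuousType _ _) q.2) (x, t)); last first.
  exact: eval_path_continuous.
apply: continuous_pair; last exact: cvg_snd.
apply: (@continuous_comp _ _ _ fst h (x, t)); first exact: cvg_fst.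
by apply: ch; rewrite inE.
Qed.

(** Outside U the map K need not be continuous in t, so there h takes an
    arbitrary constant path. *)
Lemma curry_path_within (R : realType) (T X : topologicalType) (U : set T)
    (K : T * unit_interval R -> X) :
  open U -> {within U `*` setT, continuous K} ->
  exists h : T -> path_space R X, {within U, continuous h} /\
    forall x, U x -> (h x : continuousType _ _) =1 (fun t => K (x, t)).
Proof.
move=> oU; rewrite continuous_open_subspace; last exact: openX_setT.
move=> cK.
have cKU : continuous (fun q : set_type U * unit_interval R =>
                         K (set_val q.1, q.2)).
  move=> [x t]; apply: (@continuous_comp _ _ _
    (fun q : set_type U * unit_interval R => (set_val q.1, q.2)) K (x, t)).
    apply: continuous_pair; last exact: cvg_snd.
    apply: (@continuous_comp _ _ _ fst set_val (x, t)); first exact: cvg_fst.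
    exact: initial_continuous.
  by apply: cK; rewrite inE; split=> //=; exact: set_valP.
have [_ cKt] := continuous_curry cKU.
pose h x : path_space R X :=
  if pselect (U x) is left Ux
  then mkcts (cKt (exist _ x (mem_set Ux)))
  else (cst (K (x, I0 R)) : continuousType _ _).
have hE x : U x -> (h x : continuousType _ _) =1 (fun t => K (x, t)).
  by move=> Ux t; rewrite /h; case: pselect.
exists h; split=> //; apply/subspace_sigL_continuousP.
apply: continuous_comp_initial.
rewrite (_ : _ \o _ = curry (fun q : set_type U * unit_interval R =>
                         K (set_val q.1, q.2))).
  exact: continuous_curry_fun.
by apply/funext => x; apply/funext => t; rewrite /= hE //; exact: set_valP.
Qed.

(** * Path-connectedness *)

Definition joined (R : realType) (X : topologicalType) (x y : X) :=
  exists2 g : unit_interval R -> X, continuous g & g (I0 R) = x /\ g (I1 R) = y.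

(** In a chart, segments starting at the image of x stay in a small ball around
    it, so their preimages are paths starting at x. *)
Lemma chart_joined_near (R : realType) (n : nat) (M : topologicalType)
    (phi : chart R n M) (x : M) :
  is_chart phi -> chart_dom phi x -> \forall y \near x, joined R x y.
Proof.
move=> [oD oI phiK cphi cinv] Dx.
set D := chart_dom phi in oD phiK cphi Dx *; set I := _ @` D in oI cinv.
have Ipx : I (chart_fun phi x) by exists x.
have [e /= e0 eI] : exists2 e : R, 0 < e & ball (chart_fun phi x) e `<=` I.
  by apply/nbhs_ballP; exact: open_nbhs_nbhs.
have cphix : {for x, continuous (chart_fun phi)}.
  move: cphi; rewrite continuous_open_subspace // => /(_ x); apply.
  by rewrite inE.
near=> y.
have Dy : D y by near: y; exact: open_nbhs_nbhs.
have pye : ball (chart_fun phi x) e (chart_fun phi y).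
  by near: y; apply: cphix; exact: nbhsx_ballx.
pose l (t : unit_interval R) :=
  chart_fun phi x + set_val t *: (chart_fun phi y - chart_fun phi x).
have lI t : I (l t).
  apply: eI; move: pye; rewrite -!ball_normE /= /l.
  rewrite -normrN opprB => pye.
  rewrite opprD addrA subrr sub0r normrN normrZ.
  have := set_valP t; rewrite /= in_itv /= => /andP[t0 t1].
  by rewrite ger0_norm //; apply: le_lt_trans pye; exact: ler_piMl.
have cl : continuous l.
  move=> t; apply: (@continuous_comp (unit_interval R) R _ set_val
    (fun r : R => chart_fun phi x + r *: (chart_fun phi y - chart_fun phi x)) t).
    exact: initial_continuous.
  apply: continuousD; first exact: cvg_cst.
  by apply: continuousZr_tmp; exact: cvg_id.
exists (chart_inv phi \o l).
  move=> t; apply: continuous_comp; first exact: cl.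
  move: cinv; rewrite continuous_open_subspace // => /(_ (l t)); apply.
  by rewrite inE.
by split; rewrite /= /l /= ?scale0r ?scale1r ?addr0 ?subrKC phiK.
Unshelve. all: by end_near. Qed.

(** * Lie groups as topological groups *)

Section LieGroupTopology.
Variables (R : realType) (n : nat) (G : lieGroupType R n).
Local Open Scope group_scope.

Lemma lie_mul_continuous : continuous (fun p : G * G => p.1 * p.2).
Proof. by case: (@lie_mul_smooth R n G). Qed.

Lemma lie_inv_continuous : continuous (fun x : G => x^-1).
Proof. by case: (@lie_inv_smooth R n G). Qed.

Lemma continuous_at_lie_mul (T : topologicalType) (f g : T -> G) (x : T) :
  {for x, continuous f} -> {for x, continuous g} ->
  {for x, continuous (fun y => f y * g y)}.
Proof.
move=> cf cg; apply: (@continuous_comp T (G * G)%type G (fun y => (f y, g y))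
  (fun p => p.1 * p.2) x).
  exact: continuous_pair.
exact: lie_mul_continuous.
Qed.

Lemma continuous_at_lie_inv (T : topologicalType) (f : T -> G) (x : T) :
  {for x, continuous f} -> {for x, continuous (fun y => (f y)^-1)}.
Proof.
by move=> cf; apply: (continuous_comp cf); exact: lie_inv_continuous.
Qed.

Lemma lie_left_div_continuous : continuous (fun p : G * G => p.2^-1 * p.1).
Proof.
move=> p; apply: (@continuous_at_lie_mul (G * G)%type); last exact: cvg_fst.
by apply: continuous_at_lie_inv; exact: cvg_snd.
Qed.

(** P is open, being a union of left translates of a neighbourhood of 1, and so
    is its complement, being a union of left cosets of P. *)
Lemma connected_subgroup_full (P : set G) :
  connected [set: G] -> nbhs (1 : G) P ->
  (forall x y, P x -> P y -> P (x * y)) -> (forall x, P x -> P x^-1) ->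
  P = setT.
Proof.
move=> conG P1 PM PV.
have near_coset x : \forall y \near x, P (x^-1 * y).
  have c : {for x, continuous (fun y => x^-1 * y)}.
    by apply: continuous_at_lie_mul; [exact: cvg_cst|exact: cvg_id].
  by apply: c; rewrite mulVg.
apply: conG; first by exists 1; exact: nbhs_singleton.
- exists P; last by rewrite setTI.
  rewrite openE => x Px; apply: filterS (near_coset x) => y Py.
  by rewrite -(mulVKg x y); exact: PM.
- exists P; last by rewrite setTI.
  rewrite -openC openE => x nPx; apply: filterS (near_coset x) => y Pxy Py.
  apply: nPx; have := PM _ _ Py (PV _ Pxy).
  by rewrite invgM invgK mulVKg.
Qed.

(** The points joined to 1 form a subgroup under pointwise product and inverse
    of paths. *)
Lemma connected_joined1 (x : G) : connected [set: G] -> joined R 1 x.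
Proof.
move=> conG; suff -> : joined R (1 : G) = setT by [].
apply: connected_subgroup_full => //.
- have [ach cov _] := @lie_atlas_smooth R n G.
  by have [phi Aphi Dphi] := cov 1; exact: chart_joined_near (ach _ Aphi) Dphi.
- move=> y z [g cg [g0 g1]] [h ch [h0 h1]].
  exists (fun t => g t * h t).
    by move=> t; apply: continuous_at_lie_mul; [exact: cg|exact: ch].
  by rewrite g0 g1 h0 h1 mulg1.
- move=> y [g cg [g0 g1]].
  exists (fun t => (g t)^-1).
    by move=> t; apply: continuous_at_lie_inv; exact: cg.
  by rewrite g0 g1 invg1.
Qed.

(** Right multiplication of a contraction by a path g starting at 1 leaves its
    beginning unchanged; g is chosen so that the new contraction ends at 1 and,
    when 1 lies in U, cancels the track of 1. *)
Lemma contractible_in_pointed (U : set G) :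
  connected [set: G] -> open U -> contractible_in R U ->
  exists H : G * unit_interval R -> G,
    [/\ {within U `*` setT, continuous H},
        forall x, U x -> H (x, I0 R) = x /\ H (x, I1 R) = 1 &
        U 1 -> forall t, H (1, t) = 1].
Proof.
move=> conG oU [x0 [H [cH H01]]].
have oUT : open (U `*` [set: unit_interval R]) by exact: openX_setT.
rewrite continuous_open_subspace // in cH.
have [g cg [g0 g1 gU]] : exists2 g : unit_interval R -> G, continuous g &
    [/\ g (I0 R) = 1, g (I1 R) = x0^-1 & U 1 -> forall t, H (1, t) * g t = 1].
  have [U1|nU1] := pselect (U 1); last first.
    by have [g cg [g0 g1]] := connected_joined1 x0^-1 conG; exists g.
  have [H0 H1] := H01 _ U1.
  exists (fun t => (H (1, t))^-1).
    move=> t; apply: continuous_at_lie_inv.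
    apply: (@continuous_comp _ _ _ (fun t => (1, t) : G * unit_interval R) H t).
      by apply: continuous_pair; [exact: cst_continuous|exact: cvg_id].
    by apply: cH; rewrite inE.
  by rewrite H0 H1 invg1; split=> // _ t; exact: mulgV.
exists (fun q => H q * g q.2); split=> //.
- rewrite continuous_open_subspace // => q Uq.
  apply: continuous_at_lie_mul; first exact: cH.
  by apply: (@continuous_comp _ _ _ snd g); [exact: cvg_snd|exact: cg].
- by move=> x /H01[H0 H1] /=; rewrite H0 H1 g0 g1 mulg1 mulgV.
Qed.

(** * Sections and contractions *)

Lemma section_contractible (U : set (G * G)) (s : G * G -> path_space R G) :
  open U -> is_section U s -> contractible_in R [set x | U (x, 1)].
Proof.
move=> oU [cs sU].
have ci : continuous (fun x : G => (x, 1 : G)).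
  by move=> x; apply: continuous_pair; [exact: cvg_id|exact: cvg_cst].
have oV : open [set x | U (x, 1)] by apply: open_comp => // x _; exact: ci.
exists 1, (fun q => (s (q.1, 1) : continuousType _ _) q.2); split; last first.
  by move=> x /sU [-> ->].
apply: (uncurry_path_within (h := fun x => s (x, 1))) => //.
move: cs; rewrite !continuous_open_subspace // => cs x Vx.
apply: (@continuous_comp _ _ _ (fun x => (x, 1) : G * G) s x); first exact: ci.
by apply: cs; move: Vx; rewrite !inE.
Qed.

(** The section is left-equivariant: the path from a to b is the translate by b
    of the track of b^-1 * a under a contraction to 1. *)
Lemma contractible_reserved_section (U : set G) :
  connected [set: G] -> open U -> contractible_in R U ->
  exists s : G * G -> path_space R G,
    is_section [set p | U (p.2^-1 * p.1)] s /\
    reserved_on [set p | U (p.2^-1 * p.1)] s.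
Proof.
move=> conG oU /(contractible_in_pointed conG oU)[H [cH H01 H1]].
have cd := lie_left_div_continuous.
set W := [set p | _]; have oW : open W by apply: open_comp => // x _; exact: cd.
have [|s [cs sE]] := @curry_path_within R (G * G)%type G W
    (fun q => q.1.2 * H (q.1.2^-1 * q.1.1, q.2)) oW.
  rewrite continuous_open_subspace; last exact: openX_setT.
  move=> [p t]; rewrite inE => -[/= Wp _].
  apply: (@continuous_at_lie_mul (G * G * unit_interval R)%type
    (fun q => q.1.2)).
    by apply: (@continuous_comp _ _ _ fst snd); [exact: cvg_fst|exact: cvg_snd].
  apply: (@continuous_comp _ _ _
    (fun q : G * G * unit_interval R => (q.1.2^-1 * q.1.1, q.2)) H (p, t)).
    apply: continuous_pair; last exact: cvg_snd.
    by apply: (@continuous_comp _ _ _ fst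
      (fun p : G * G => p.2^-1 * p.1) (p, t)); [exact: cvg_fst|exact: cd].
  move: cH; rewrite continuous_open_subspace; last exact: openX_setT.
  by apply; rewrite inE.
exists s; split; [split=> //|].
- move=> [a b] Wab; have [H0 H1'] := H01 _ Wab.
  by rewrite /endpoints !sE //= H0 H1' mulVKg mulg1.
- move=> x Wx; apply/continuousEP => t; rewrite sE //= mulVg H1 ?mulg1 //.
  by move: Wx; rewrite /W /= mulVg.
Qed.

End LieGroupTopology.

(** * Comparison of the invariants *)

Lemma open_cover_by_preimage (X Y : topologicalType) (f : X -> Y)
    (P : set Y -> Prop) (Q : set X -> Prop) (k : nat) :
  continuous f -> (forall U, open U -> P U -> Q (f @^-1` U)) ->
  open_cover_by P k -> open_cover_by Q k.
Proof.
move=> cf PQ [U [oU cU PU]]; exists (fun i => f @^-1` U i); split.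
- by move=> i; apply: open_comp => // x _; exact: cf.
- by rewrite -preimage_bigcup cU preimage_setT.
- by move=> i; exact: PQ.
Qed.

Lemma eq_least (P Q : nat -> Prop) :
  (forall k, P k <-> Q k) -> least P = least Q.
Proof. by move=> PQ; congr least; apply/funext => k; apply/propext. Qed.

Theorem lemma2p7 (R : realType) (n : nat) (G : lieGroupType R n) :
  connected [set: G]%classic ->
  TC R G = TCM R G /\ TCM R G = LScat R G.
Proof.
move=> conG.
set tc := fun U : set (G * G) => exists s : G * G -> path_space R G,
  is_section U s.
set tcm := fun U : set (G * G) => exists s : G * G -> path_space R G,
  is_section U s /\ reserved_on U s.
have tcm_tc k : open_cover_by tcm k -> open_cover_by tc k.
  apply: (@open_cover_by_preimage _ _ id); first by move=> x; exact: cvg_id.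
  by move=> U _ [s [? _]]; exists s.
have tc_cat k : open_cover_by tc k -> open_cover_by (@contractible_in R G) k.
  apply: (@open_cover_by_preimage _ _ (fun x : G => (x, 1%g : G))).
    by move=> x; apply: continuous_pair; [exact: cvg_id|exact: cvg_cst].
  by move=> U oU [s]; exact: section_contractible.
have cat_tcm k : open_cover_by (@contractible_in R G) k -> open_cover_by tcm k.
  apply: (@open_cover_by_preimage _ _ (fun p : G * G => (p.2^-1 * p.1)%g)).
    exact: lie_left_div_continuous.
  by move=> U; exact: contractible_reserved_section.
by split; apply: eq_least => k; split; auto.
Qed.
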